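(* Let $F$ be a field, $p$ a prime number and $A$ a unital $F$-algebra. Consider the conditions - $(c_1^* )$: $\operatorname{M}_{p^\infty}(F)\otimes A\cong A$; - $(c_1)$: $\operatorname{M}_p(F)\otimes A\cong A$; - $(c_2)$: $\operatorname{M}_p(F)\otimes A\mid A$; - $(c_3^* )$: $\operatorname{M}_{p^\infty}(F)\otimes A\hookrightarrow A$; - $(c_3)$: $\operatorname{M}_p(F)\otimes A\hookrightarrow A$; - $(c_4^* )$: $\operatorname{M}_{p^\infty}(F)\hookrightarrow A$; - $(c_4)$: $\operatorname{M}_{p^n}(F)\hookrightarrow A$ for all $n$. Then $$(c_1^* )\Rightarrow(c_1)\Rightarrow(c_2)\Rightarrow(c_3)\Rightarrow(c_4^* )\Rightarrow(c_4)$$ and $(c_1^* )\Rightarrow(c_3^* )\Rightarrow(c_3)$.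
   Context: All algebras are unital $F$-algebras; tensor products are over $F$; $\cong$ denotes isomorphism and $B\hookrightarrow C$ means that there is an embedding (injective homomorphism) of unital algebras. An algebra $B$ is a factor in an algebra $C$, written $B\mid C$, if $C\cong B\otimes B'$ for some algebra $B'$ (via a copy of $B$ inside $C$). $\operatorname{M}_{p^\infty}(F)=\varinjlim_n\operatorname{M}_{p^n}(F)$ is the direct limit along the diagonal embeddings $x\mapsto x\otimes 1=\operatorname{diag}(x,\dots,x)$. *)

(* Defs.v *)
From HB Require Import structures.
From mathcomp Require Import all_boot all_order all_algebra generic_quotient.
From mathcomp Require Import boolp classical_sets.

Set Implicit Arguments.
Unset Strict Implicit.
Unset Printing Implicit Defensive.
Import GRing.Theory.
Local Open Scope ring_scope.
Local Open Scope quotient_scope.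

(* An [algType F] is a unital associative F-algebra with 1 != 0, and a        *)
(* [{lrmorphism B -> C}] is an F-linear map preserving products and 1.        *)

Definition alg_iso (F : fieldType) (B C : algType F) : Prop :=
  exists f : {lrmorphism B -> C}, bijective f.

Definition alg_embeds (F : fieldType) (B C : algType F) : Prop :=
  exists f : {lrmorphism B -> C}, injective f.

(* Linear functionals separate points: needed only to see that 1 != 0 in a    *)
(* tensor product.                                                            *)
Lemma functional_exists (F : fieldType) (V : lmodType F) (v : V) :
  v != 0 -> exists f : V -> F, scalar f /\ f v = 1.
Proof.
move=> v0.
pose sub (W : set V) := W 0 /\ forall a x y, W x -> W y -> W (a *: x + y).
pose P (W : set V) := (forall x, W x -> sub W) /\ ~ W v.
have [G GP totG|W [[WS Wv] Wmax]] := @Zorn_bigcup V P.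
  split; last by case=> X GX Xv; case: (GP _ GX).
  move=> x0 [X0 GX0 X0x0]; split.
    by exists X0 => //; have [/(_ _ X0x0) [] ] := GP _ GX0.
  move=> a x y [X GX Xx] [Y GY Yy].
  have [XY|YX] := totG _ _ GX GY.
    exists Y => //; have [/(_ _ Yy) [_ YS] _] := GP _ GY.
    by apply: YS => //; apply: XY.
  exists X => //; have [/(_ _ Xx) [_ XS] _] := GP _ GX.
  by apply: XS => //; apply: YX.
have W0 : W 0.
  apply: contrapT => nW0; apply: (Wmax (fun x : V => x = 0)).
    split; first by move=> x Wx; case: nW0; case: (WS _ Wx).
    by move=> /(_ 0 erefl).
  split; last by move=> /= v00; rewrite v00 eqxx in v0.
  move=> x _; split=> // a y z y0 z0.
  by rewrite y0 z0 scaler0 addr0.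
have [_ WL] := WS _ W0.
have WZ a x : W x -> W (a *: x) by move=> Wx; rewrite -[_ *: _]addr0; apply: WL.
have WD x y : W x -> W y -> W (x + y).
  by move=> Wx Wy; rewrite -[x]scale1r; apply: WL.
have WN x : W x -> W (- x) by rewrite -scaleN1r; apply: WZ.
have dec x : exists c, W (x - c *: v).
  have [Wx|nWx] := pselect (W x); first by exists 0; rewrite scale0r subr0.
  pose U : set V := fun y => exists a, W (y - a *: x).
  have WU : (W `<` U)%classic.
    split; first by move=> y Wy; exists 0; rewrite scale0r subr0.
    by move=> /(_ x); apply: contra_not (nWx) => h; apply: h; exists 1; rewrite scale1r subrr.
  have nPU := Wmax _ WU.
  have [[a Wa]|nUv] := pselect (U v).
    have a0 : a != 0 by apply/eqP => a0; move: Wa; rewrite a0 scale0r subr0.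
    exists a^-1.
    have := WZ (- a^-1) _ Wa.
    by rewrite scalerBr scalerA !scaleNr mulNr mulVf // scaleN1r opprK addrC.
  case: nPU; split => // y0 _; split; first by exists 0; rewrite scale0r subr0.
  move=> a y z [b Wb] [c Wc]; exists (a * b + c).
  by rewrite scalerDl opprD addrACA -scalerA -scalerBr; apply: WL.
have uniq c d x : W (x - c *: v) -> W (x - d *: v) -> c = d.
  move=> Wc Wd; apply: contrapT => /eqP cd; apply: Wv.
  have := WZ (d - c)^-1 _ (WD _ _ Wc (WN _ Wd)).
  have -> : x - c *: v - (x - d *: v) = (d - c) *: v.
    by rewrite opprB addrC addrA subrK -scalerBl.
  by rewrite scalerA mulVf ?scale1r // subr_eq0 eq_sym.
have [f Wf] := choice dec.
exists f; split.
  move=> a x y; apply: (uniq _ _ (a *: x + y)); first exact: Wf.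
  rewrite scalerDl opprD addrACA -[_ *: x + _](_ : a *: (x - f x *: v) = _).
    exact: WL.
  by rewrite scalerBr scalerA.
by apply: (uniq _ _ v); [exact: Wf|rewrite scale1r subrr].
Qed.

(* The tensor product: finite formal sums of pairs (b, c), modulo the         *)
(* congruence generated by commutativity of the sum and bilinearity of the    *)
(* symbol (b, c).                                                             *)
Section Tensor.
Variables (F : fieldType) (B C : algType F).

Inductive tens_rel : seq (B * C) -> seq (B * C) -> Prop :=
| tens_refl s : tens_rel s s
| tens_sym s t : tens_rel s t -> tens_rel t s
| tens_trans s t u : tens_rel s t -> tens_rel t u -> tens_rel s u
| tens_cat s s' t t' :
    tens_rel s s' -> tens_rel t t' -> tens_rel (s ++ t) (s' ++ t')
| tens_catC s t : tens_rel (s ++ t) (t ++ s)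
| tens_0 c : tens_rel [:: (0, c)] [::]
| tens_Dl b b' c : tens_rel [:: (b + b', c)] [:: (b, c); (b', c)]
| tens_Dr b c c' : tens_rel [:: (b, c + c')] [:: (b, c); (b, c')]
| tens_Z a b c : tens_rel [:: (a *: b, c)] [:: (b, a *: c)].

Definition tens_relb (s t : seq (B * C)) : bool := `[< tens_rel s t >].

Lemma tens_relb_refl : reflexive tens_relb.
Proof. by move=> s; apply/asboolP; exact: tens_refl. Qed.
Lemma tens_relb_sym : symmetric tens_relb.
Proof. by move=> s t; apply/asboolP/asboolP; exact: tens_sym. Qed.
Lemma tens_relb_trans : transitive tens_relb.
Proof.
by move=> s t u /asboolP h /asboolP h'; apply/asboolP; exact: tens_trans h h'.
Qed.

Canonical tens_equiv :=
  EquivRel tens_relb tens_relb_refl tens_relb_sym tens_relb_trans.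

Definition tensor := {eq_quot tens_equiv}.
HB.instance Definition _ := Choice.on tensor.
HB.instance Definition _ := EqQuotient.on tensor.

Definition tens_class (s : seq (B * C)) : tensor := \pi_tensor s.
Definition tens (b : B) (c : C) : tensor := tens_class [:: (b, c)].

Lemma tens_classP s t : tens_class s = tens_class t <-> tens_rel s t.
Proof.
split=> [/eqP|h]; first by rewrite eqquotE => /asboolP.
by apply/eqP; rewrite eqquotE; apply/asboolP.
Qed.

Lemma tens_reprK x : tens_class (repr x) = x.
Proof. exact: reprK. Qed.

Lemma tens_repr s : tens_rel (repr (tens_class s)) s.
Proof. by apply/tens_classP; rewrite tens_reprK. Qed.

Definition seqZ (a : F) (s : seq (B * C)) := [seq (a *: x.1, x.2) | x <- s].
Definition seqM (s t : seq (B * C)) :=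
  [seq (x.1 * y.1, x.2 * y.2) | x <- s, y <- t].

Definition tens_zero : tensor := tens_class [::].
Definition tens_add (x y : tensor) := tens_class (repr x ++ repr y).
Definition tens_scale (a : F) (x : tensor) := tens_class (seqZ a (repr x)).
Definition tens_opp (x : tensor) := tens_scale (-1) x.
Definition tens_one : tensor := tens 1 1.
Definition tens_mul (x y : tensor) := tens_class (seqM (repr x) (repr y)).

Lemma tens_perm s t : perm_eq s t -> tens_rel s t.
Proof.
elim: s t => [|x s IH] t; first by rewrite perm_sym => /perm_nilP ->; exact: tens_refl.
move=> st; have xt : x \in t by rewrite -(perm_mem st) mem_head.
case/splitPr: xt st => t1 t2 st.
have {}st : perm_eq s (t2 ++ t1).
  by rewrite -(perm_cons x); apply: (perm_trans st); rewrite perm_catC.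
apply: tens_trans (tens_catC (x :: t2) t1).
by apply: (tens_cat (tens_refl [:: x]) (IH _ st)).
Qed.

Lemma seqZ_rel a s t : tens_rel s t -> tens_rel (seqZ a s) (seqZ a t).
Proof.
elim=> {s t} [s|s t _|s t u _ h _|s s' t t' _ h _ h'|s t|c|b b' c|b c c'|k b c].
- exact: tens_refl.
- exact: tens_sym.
- exact: tens_trans.
- by rewrite /seqZ !map_cat; exact: tens_cat.
- by rewrite /seqZ !map_cat; exact: tens_catC.
- by rewrite /= scaler0; exact: tens_0.
- by rewrite /= scalerDr; exact: tens_Dl.
- exact: tens_Dr.
- by rewrite /= scalerA mulrC -scalerA; exact: tens_Z.
Qed.

Lemma seqM_cons x s t :
  seqM (x :: s) t = [seq (x.1 * y.1, x.2 * y.2) | y <- t] ++ seqM s t.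
Proof. by []. Qed.

Lemma seqM1_rel x s t : tens_rel s t -> tens_rel (seqM [:: x] s) (seqM [:: x] t).
Proof.
rewrite !seqM_cons !cats0 /=.
elim=> {s t} [s|s t _|s t u _ h _|s s' t t' _ h _ h'|s t|c|b b' c|b c c'|k b c].
- exact: tens_refl.
- exact: tens_sym.
- exact: tens_trans.
- by rewrite !map_cat; exact: tens_cat.
- by rewrite !map_cat; exact: tens_catC.
- by rewrite /= mulr0; exact: tens_0.
- by rewrite /= mulrDr; exact: tens_Dl.
- by rewrite /= mulrDr; exact: tens_Dr.
- by rewrite /= -!scalerAr; exact: tens_Z.
Qed.

Lemma seqMr_rel s t t' : tens_rel t t' -> tens_rel (seqM s t) (seqM s t').
Proof.
move=> h; elim: s => [|x s IH]; first exact: tens_refl.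
rewrite !seqM_cons; apply: tens_cat => //.
by have := seqM1_rel x h; rewrite !seqM_cons !cats0.
Qed.

Lemma seqMl_rel s s' t : tens_rel s s' -> tens_rel (seqM s t) (seqM s' t).
Proof.
elim=> {s s'} [s|s s' _|s u v _ h _|s s' u v _ h _ h'|s u|c|b b' c|b c c'|k b c].
- exact: tens_refl.
- exact: tens_sym.
- exact: tens_trans.
- by rewrite /seqM !allpairs_cat; exact: tens_cat.
- by rewrite /seqM !allpairs_cat; exact: tens_catC.
- rewrite seqM_cons cats0; elim: t => [|y t IH]; first exact: tens_refl.
  by rewrite /= mul0r; apply: (tens_cat (tens_0 _) IH).
- rewrite !seqM_cons cats0; elim: t => [|y t IH]; first exact: tens_refl.
  rewrite /= mulrDl cats0.
  apply: tens_trans (tens_cat (tens_Dl _ _ _) IH) _; apply: tens_perm.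
  by rewrite /= cats0 perm_cons -cat1s perm_catCA.
- rewrite !seqM_cons cats0; elim: t => [|y t IH]; first exact: tens_refl.
  rewrite /= mulrDl cats0.
  apply: tens_trans (tens_cat (tens_Dr _ _ _) IH) _; apply: tens_perm.
  by rewrite /= cats0 perm_cons -cat1s perm_catCA.
- rewrite !seqM_cons !cats0; elim: t => [|y t IH]; first exact: tens_refl.
  by rewrite /= -!scalerAl; apply: (tens_cat (tens_Z _ _ _) IH).
Qed.

Lemma tens_addE s t :
  tens_add (tens_class s) (tens_class t) = tens_class (s ++ t).
Proof. by apply/tens_classP/tens_cat; exact: tens_repr. Qed.

Lemma tens_scaleE a s : tens_scale a (tens_class s) = tens_class (seqZ a s).
Proof. by apply/tens_classP/seqZ_rel; exact: tens_repr. Qed.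

Lemma tens_mulE s t :
  tens_mul (tens_class s) (tens_class t) = tens_class (seqM s t).
Proof.
apply/tens_classP; apply: tens_trans (seqMl_rel _ (tens_repr s)) _.
exact: seqMr_rel (tens_repr t).
Qed.

Lemma tens_addA : associative tens_add.
Proof.
move=> x y z; rewrite -(tens_reprK x) -(tens_reprK y) -(tens_reprK z).
by rewrite !tens_addE catA.
Qed.

Lemma tens_addC : commutative tens_add.
Proof.
move=> x y; rewrite -(tens_reprK x) -(tens_reprK y) !tens_addE.
by apply/tens_classP; exact: tens_catC.
Qed.

Lemma tens_add0 : left_id tens_zero tens_add.
Proof. by move=> x; rewrite -(tens_reprK x) tens_addE. Qed.

Lemma tens_addN : left_inverse tens_zero tens_opp tens_add.
Proof.
move=> x; rewrite -(tens_reprK x) /tens_opp tens_scaleE tens_addE.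
apply/tens_classP; elim: (repr x) => [|[b c] s IH]; first exact: tens_refl.
apply: (@tens_trans _ ([:: (- 1 *: b, c); (b, c)] ++ (seqZ (-1) s ++ s))).
  by apply: tens_perm; rewrite /= perm_cons -cat1s perm_catCA.
rewrite -[X in tens_rel _ X]cats0; apply: tens_cat IH.
rewrite scaleN1r; apply: tens_trans (tens_0 c); rewrite -(addNr b).
exact/tens_sym/tens_Dl.
Qed.

HB.instance Definition _ := GRing.isZmodule.Build tensor
  tens_addA tens_addC tens_add0 tens_addN.

Lemma tens_ind (P : tensor -> Prop) :
  P 0 -> (forall b c x, P x -> P (tens b c + x)) -> forall x, P x.
Proof.
move=> P0 PD x; rewrite -(tens_reprK x).
elim: (repr x) => [|[b c] s IH] //.
by have := PD b c _ IH; rewrite /tens /GRing.add /= tens_addE.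
Qed.

Lemma tensDl b b' c : tens (b + b') c = tens b c + tens b' c.
Proof. by rewrite [RHS]tens_addE; apply/tens_classP; exact: tens_Dl. Qed.

Lemma tensDr b c c' : tens b (c + c') = tens b c + tens b c'.
Proof. by rewrite [RHS]tens_addE; apply/tens_classP; exact: tens_Dr. Qed.

Lemma tens_scaleDr : right_distributive tens_scale +%R.
Proof.
move=> a x y; rewrite -(tens_reprK x) -(tens_reprK y).
rewrite [in LHS]/GRing.add /= tens_addE !tens_scaleE.
by rewrite [RHS]tens_addE /seqZ map_cat.
Qed.

Lemma tens_scale_pure a b c : tens_scale a (tens b c) = tens (a *: b) c.
Proof. exact: tens_scaleE. Qed.

Lemma tens_scale0 a : tens_scale a 0 = 0.
Proof. exact: tens_scaleE. Qed.

Lemma tens_scaleA a b x : tens_scale a (tens_scale b x) = tens_scale (a * b) x.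
Proof.
elim/tens_ind: x => [|u v x IH]; first by rewrite !tens_scale0.
by rewrite !tens_scaleDr IH !tens_scale_pure scalerA.
Qed.

Lemma tens_scale1 : left_id 1 tens_scale.
Proof.
elim/tens_ind => [|u v x IH]; first by rewrite tens_scale0.
by rewrite tens_scaleDr IH tens_scale_pure scale1r.
Qed.

Lemma tens_scaleDl x : {morph tens_scale^~ x : a b / a + b}.
Proof.
move=> a b; elim/tens_ind: x => [|u v x IH].
  by rewrite !tens_scale0 addr0.
by rewrite !tens_scaleDr IH !tens_scale_pure scalerDl tensDl addrACA.
Qed.

HB.instance Definition _ := GRing.Zmodule_isLmodule.Build F tensor
  tens_scaleA tens_scale1 tens_scaleDr tens_scaleDl.

Lemma tensZl a b c : tens (a *: b) c = a *: tens b c.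
Proof. by rewrite [RHS]tens_scale_pure. Qed.

Lemma tensZr a b c : tens b (a *: c) = a *: tens b c.
Proof.
by rewrite -tensZl; apply/tens_classP/tens_sym; exact: tens_Z.
Qed.

Lemma tens_mulDl : left_distributive tens_mul +%R.
Proof.
move=> x y z; rewrite -(tens_reprK x) -(tens_reprK y) -(tens_reprK z).
rewrite [in LHS]/GRing.add /= tens_addE !tens_mulE.
by rewrite [RHS]tens_addE /seqM allpairs_cat.
Qed.

Lemma tens_mul_pure b c b' c' :
  tens_mul (tens b c) (tens b' c') = tens (b * b') (c * c').
Proof. exact: tens_mulE. Qed.

Lemma tens_mul0l x : tens_mul 0 x = 0.
Proof. by rewrite -(tens_reprK x) [LHS]tens_mulE. Qed.

Lemma tens_mulDr : right_distributive tens_mul +%R.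
Proof.
move=> x y z; elim/tens_ind: x => [|b c x IH].
  by rewrite !tens_mul0l addr0.
rewrite !tens_mulDl IH [RHS]addrACA; congr (_ + _).
rewrite -(tens_reprK y) -(tens_reprK z) [in LHS]/GRing.add /= tens_addE.
rewrite !tens_mulE [RHS]tens_addE.
by rewrite !seqM_cons !cats0 map_cat.
Qed.

Lemma tens_mul0r x : tens_mul x 0 = 0.
Proof.
by apply: (@addrI _ (tens_mul x 0)); rewrite -tens_mulDr !addr0.
Qed.

Lemma tens_mulA : associative tens_mul.
Proof.
move=> x y z; elim/tens_ind: x => [|b c x IHx].
  by rewrite !tens_mul0l.
rewrite !tens_mulDl IHx {IHx}; congr (_ + _).
elim/tens_ind: y => [|b' c' y IHy].
  by rewrite !(tens_mul0r, tens_mul0l).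
rewrite !(tens_mulDl, tens_mulDr) IHy {IHy}; congr (_ + _).
elim/tens_ind: z => [|b'' c'' z IHz]; first by rewrite !tens_mul0r.
by rewrite !tens_mulDr IHz !tens_mul_pure !mulrA.
Qed.

Lemma tens_mul1l : left_id tens_one tens_mul.
Proof.
elim/tens_ind => [|b c x IH]; first exact: tens_mul0r.
by rewrite tens_mulDr IH tens_mul_pure !mul1r.
Qed.

Lemma tens_mul1r : right_id tens_one tens_mul.
Proof.
elim/tens_ind => [|b c x IH]; first exact: tens_mul0l.
by rewrite tens_mulDl IH tens_mul_pure !mulr1.
Qed.

Section Universal.
Variables (V : lmodType F) (beta : B -> C -> V).
Hypothesis beta_l : forall c, linear (beta^~ c).
Hypothesis beta_r : forall b, linear (beta b).

Definition tens_lift (x : tensor) : V := \sum_(y <- repr x) beta y.1 y.2.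

Lemma tens_lift_rel s t : tens_rel s t ->
  \sum_(y <- s) beta y.1 y.2 = \sum_(y <- t) beta y.1 y.2.
Proof.
have l0 c : beta 0 c = 0.
  by have := beta_l c (-1) 0 0; rewrite scaleN1r oppr0 addr0 scaleN1r addNr.
have r0 b : beta b 0 = 0.
  by have := beta_r b (-1) 0 0; rewrite scaleN1r oppr0 addr0 scaleN1r addNr.
elim=> {s t} [s|s t _|s t u _ h _|s s' t t' _ h _ h'|s t|c|b b' c|b c c'|k b c] //.
- by rewrite h.
- by rewrite !big_cat /= h h'.
- by rewrite !big_cat /= addrC.
- by rewrite big_seq1 big_nil.
- rewrite big_seq1 big_cons big_seq1 /=.
  by have := beta_l c 1 b b'; rewrite !scale1r.
- rewrite big_seq1 big_cons big_seq1 /=.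
  by have := beta_r b 1 c c'; rewrite !scale1r.
- rewrite !big_seq1 /=; have := beta_l c k b 0; have := beta_r b k c 0.
  by rewrite r0 l0 !addr0 => -> ->.
Qed.

Lemma tens_lift_class s :
  tens_lift (tens_class s) = \sum_(y <- s) beta y.1 y.2.
Proof. exact: tens_lift_rel (tens_repr s). Qed.

Lemma tens_lift_pure b c : tens_lift (tens b c) = beta b c.
Proof. by rewrite tens_lift_class big_seq1. Qed.

Lemma tens_lift_linear : linear tens_lift.
Proof.
have l0 c : beta 0 c = 0.
  by have := beta_l c (-1) 0 0; rewrite scaleN1r oppr0 addr0 scaleN1r addNr.
move=> a x y; rewrite -(tens_reprK x) -(tens_reprK y).
have -> : a *: tens_class (repr x) + tens_class (repr y)
    = tens_class (seqZ a (repr x) ++ repr y).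
  rewrite -tens_addE; congr (_ + _ : tensor); exact: tens_scaleE.
rewrite !tens_lift_class big_cat /= big_map scaler_sumr; congr (_ + _).
apply: eq_bigr => z _ /=.
by have := beta_l z.2 a z.1 0; rewrite l0 !addr0.
Qed.

Lemma tens_lift_unique (g : tensor -> V) : linear g ->
  (forall b c, g (tens b c) = beta b c) -> g =1 tens_lift.
Proof.
move=> gL gE; elim/tens_ind => [|b c x IH].
  have := gL (-1) 0 0; rewrite scaleN1r oppr0 addr0 scaleN1r addNr => ->.
  by have := tens_lift_class [::]; rewrite big_nil.
have := gL 1 (tens b c) x; have := tens_lift_linear 1 (tens b c) x.
by rewrite !scale1r gE tens_lift_pure IH => -> ->.
Qed.

End Universal.

Lemma tens_one_neq0 : tens_one != 0 :> tensor.
Proof.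
apply/eqP => e.
have [f [fL f1]] := functional_exists (oner_neq0 B).
have [g [gL g1]] := functional_exists (oner_neq0 C).
pose beta (b : B) (c : C) : F^o := f b * g c.
have bl c : linear (beta^~ c).
  by move=> a x y; rewrite /beta fL mulrDl -mulrA.
have br b : linear (beta b).
  by move=> a x y; rewrite /beta gL mulrDr mulrCA.
have := tens_lift_pure bl br 1 1; rewrite [tens 1 1]e.
have -> := tens_lift_class bl br [::]; rewrite big_nil /beta f1 g1 mulr1.
by move/esym/eqP; rewrite oner_eq0.
Qed.

HB.instance Definition _ := GRing.Zmodule_isNzRing.Build tensor
  tens_mulA tens_mul1l tens_mul1r tens_mulDl tens_mulDr tens_one_neq0.

Lemma tensM b c b' c' : tens b c * tens b' c' = tens (b * b') (c * c').
Proof. exact: tens_mul_pure. Qed.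

Lemma tens_scaleAl (a : F) (x y : tensor) : a *: (x * y) = (a *: x) * y.
Proof.
elim/tens_ind: x => [|b c x IH]; first by rewrite !(mul0r, scaler0).
rewrite mulrDl !scalerDr mulrDl IH {IH}; congr (_ + _).
elim/tens_ind: y => [|b' c' y IHy]; first by rewrite !(mulr0, scaler0).
by rewrite !mulrDr scalerDr IHy -tensZl !tensM -tensZl scalerAl.
Qed.

HB.instance Definition _ := GRing.Lmodule_isLalgebra.Build F tensor tens_scaleAl.

Lemma tens_scaleAr (a : F) (x y : tensor) : a *: (x * y) = x * (a *: y).
Proof.
elim/tens_ind: x => [|b c x IH]; first by rewrite !(mul0r, scaler0).
rewrite mulrDl !scalerDr mulrDl IH {IH}; congr (_ + _).
elim/tens_ind: y => [|b' c' y IHy]; first by rewrite !(mulr0, scaler0).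
rewrite !scalerDr !mulrDr scalerDr IHy; congr (_ + _).
by rewrite -tensZl !tensM -tensZl scalerAr.
Qed.

HB.instance Definition _ := GRing.Lalgebra_isAlgebra.Build F tensor tens_scaleAr.

End Tensor.

Notation "B ⊗ C" := (tensor B C) (at level 40, left associativity) : type_scope.

Definition alg_divides (F : fieldType) (B C : algType F) : Prop :=
  exists B' : algType F, alg_iso C (B ⊗ B')%type.

(* For n > 0 this is the algebra of n x n matrices; the form n.-1.+1 of the   *)
(* dimension is the one on which the library has an algType.                  *)
Notation mxalg n F := 'M[F]_(n.-1.+1).

Section Diag.
Variable F : fieldType.

(* The block matrix diag(x, ..., x), meaningful when m.+1 divides n.+1.       *)
Definition diag_emb m n (x : 'M[F]_m.+1) : 'M[F]_n.+1 :=
  \matrix_(i, j) if (i %/ m.+1 == j %/ m.+1)%N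
    then x (inord (i %% m.+1)) (inord (j %% m.+1)) else 0.

Lemma diag_emb_id m x : diag_emb m x = x.
Proof.
apply/matrixP => i j; rewrite mxE !divn_small // eqxx !modn_small //.
by rewrite !inord_val.
Qed.

Lemma diag_emb_comp m n k x : (m.+1 %| n.+1)%N ->
  diag_emb k (diag_emb n x) = diag_emb k (x : 'M_m.+1).
Proof.
move=> /[dup] mn /dvdnP [q nq]; apply/matrixP => i j; rewrite !mxE.
have q0 : (0 < q)%N by case: q nq.
have dE (a : nat) : (a %/ m.+1 = (a %/ n.+1) * q + (a %% n.+1) %/ m.+1)%N.
  by rewrite {1}(divn_eq a n.+1) {2}nq mulnA divnMDl.
have lt (a : nat) : ((a %% n.+1) %/ m.+1 < q)%N.
  by rewrite ltn_divLR // -nq ltn_mod.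
have vE (a : nat) : (inord (a %% n.+1) : 'I_n.+1) = (a %% n.+1)%N :> nat.
  by rewrite inordK // ltn_mod.
rewrite !vE !modn_dvdm //.
have [e|ne] := eqVneq (i %/ n.+1)%N (j %/ n.+1)%N.
  by rewrite (dE i) (dE j) e eqn_add2l.
case: ifP => // /eqP e; case/eqP: ne.
have := congr1 (fun a => a %/ q)%N e; rewrite /= (dE i) (dE j).
by rewrite !divnMDl // !(divn_small (lt _)) !addn0.
Qed.

Lemma diag_emb_linear m n : linear (@diag_emb m n).
Proof.
move=> a x y; apply/matrixP => i j; rewrite !mxE.
by case: ifP; rewrite ?mulr0 ?addr0.
Qed.

Lemma diag_emb1 m n : diag_emb n (1 : 'M_m.+1) = 1.
Proof.
apply/matrixP => i j; rewrite !mxE.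
have [->|ne] := eqVneq i j; first by rewrite !eqxx.
case: ifP => // /eqP e; case: eqP => // /(congr1 val) /=.
rewrite !inordK ?ltn_mod // => e'; case/eqP: ne; apply: val_inj.
by rewrite /= (divn_eq i m.+1) (divn_eq j m.+1) e e'.
Qed.

Lemma diag_embM m n (x y : 'M_m.+1) : (m.+1 %| n.+1)%N ->
  diag_emb n (x * y) = diag_emb n x * diag_emb n y.
Proof.
move=> mn; apply/matrixP => i j; rewrite !mxE.
pose h (l : 'I_m.+1) : 'I_n.+1 := inord (i %/ m.+1 * m.+1 + l).
have hE l : h l = (i %/ m.+1 * m.+1 + l)%N :> nat.
  rewrite /h inordK //; case/dvdnP: mn => q nq.
  have : (i %/ m.+1 < q)%N by rewrite ltn_divLR // -nq.
  move=> lt; apply: (@leq_trans ((i %/ m.+1).+1 * m.+1)).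
    by rewrite mulSn addnC ltn_add2r.
  by apply: (@leq_trans (q * m.+1)); [rewrite leq_mul2r lt orbT|rewrite -nq].
have hd l : (h l %/ m.+1 = i %/ m.+1)%N.
  by rewrite hE divnMDl // (divn_small (ltn_ord l)) addn0.
have hm l : (inord (h l %% m.+1) : 'I_m.+1) = l.
  by apply: val_inj; rewrite /= hE modnMDl modn_small // inordK.
rewrite [RHS](bigID (fun k : 'I_n.+1 => i %/ m.+1 == k %/ m.+1)%N) /=.
rewrite [X in _ = _ + X]big1 ?addr0; last first.
  by move=> k /negbTE ne; rewrite !mxE ne mul0r.
rewrite (reindex_onto h (fun k : 'I_n.+1 => inord (k %% m.+1))) /=; last first.
  move=> k /eqP e; apply: val_inj; rewrite /= hE inordK ?ltn_mod //= e.
  by rewrite -divn_eq.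
rewrite [RHS](eq_bigl xpredT); last by move=> l /=; rewrite hd eqxx hm eqxx.
under [RHS]eq_bigr => l _ do rewrite !mxE hd eqxx hm.
case: ifP => _; first by [].
by rewrite big1 // => l _; rewrite mulr0.
Qed.

End Diag.

Lemma dvdn_pexp p m n : (m <= n)%N -> ((p ^ m).-1.+1 %| (p ^ n).-1.+1)%N.
Proof.
move=> mn; case: p => [|p]; last by rewrite !prednK ?expn_gt0 // dvdn_exp2l.
case: m mn => [|m] mn; first exact: dvd1n.
by rewrite exp0n.
Qed.

(* The direct limit of the algebras M_(p^n)(F), n : nat, along the diagonal   *)
(* embeddings: pairs (n, x) with x in M_(p^n)(F), two of them being           *)
(* identified when their images agree at some later stage.                    *)
Section Limit.
Variables (F : fieldType) (p : nat).

Definition stage := {n : nat & mxalg (p ^ n) F}.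
HB.instance Definition _ := Choice.on stage.

Definition to_stage n k (x : mxalg (p ^ n) F) : mxalg (p ^ k) F :=
  diag_emb _ x.

Definition lim_rel (u v : stage) : bool :=
  `[< exists k, [/\ (tag u <= k)%N, (tag v <= k)%N
       & to_stage k (tagged u) = to_stage k (tagged v)] >].

Lemma to_stage_comp n m k (x : mxalg (p ^ n) F) : (n <= m)%N ->
  to_stage k (to_stage m x) = to_stage k x.
Proof. by move=> nm; apply: diag_emb_comp; exact: dvdn_pexp. Qed.

Lemma to_stage_eq n m k l (x : mxalg (p ^ n) F) (y : mxalg (p ^ m) F) :
  (n <= k)%N -> (m <= k)%N -> to_stage k x = to_stage k y ->
  to_stage l x = to_stage l y.
Proof.
by move=> nk mk e; rewrite -(to_stage_comp l x nk) e to_stage_comp.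
Qed.

Lemma lim_rel_refl : reflexive lim_rel.
Proof. by move=> u; apply/asboolP; exists (tag u). Qed.

Lemma lim_rel_sym : symmetric lim_rel.
Proof.
by move=> u v; apply/asboolP/asboolP => -[k [? ? ?]]; exists k; split.
Qed.

Lemma lim_rel_trans : transitive lim_rel.
Proof.
move=> v u w /asboolP [k [uk vk e]] /asboolP [l [vl wl f]].
apply/asboolP; exists (maxn k l); split.
- exact: leq_trans uk (leq_maxl _ _).
- exact: leq_trans wl (leq_maxr _ _).
- by rewrite (to_stage_eq _ uk vk e) (to_stage_eq _ vl wl f).
Qed.

Canonical lim_equiv :=
  EquivRel lim_rel lim_rel_refl lim_rel_sym lim_rel_trans.

Definition mxlim := {eq_quot lim_equiv}.
HB.instance Definition _ := Choice.on mxlim.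
HB.instance Definition _ := EqQuotient.on mxlim.

Definition lim_in n (x : mxalg (p ^ n) F) : mxlim :=
  \pi_mxlim (existT (fun n => mxalg (p ^ n) F) n x : stage).

Lemma lim_inP n m (x : mxalg (p ^ n) F) (y : mxalg (p ^ m) F) :
  lim_in x = lim_in y <->
  exists k, [/\ (n <= k)%N, (m <= k)%N & to_stage k x = to_stage k y].
Proof.
split=> [/eqP|h]; first by rewrite eqquotE => /asboolP.
by apply/eqP; rewrite eqquotE; apply/asboolP.
Qed.

Lemma lim_in_to n k (x : mxalg (p ^ n) F) : (n <= k)%N ->
  lim_in (to_stage k x) = lim_in x.
Proof. by move=> nk; apply/lim_inP; exists k; rewrite to_stage_comp. Qed.

Lemma lim_reprK (u : mxlim) : lim_in (tagged (repr u)) = u.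
Proof. by rewrite -[RHS]reprK; case: (repr u). Qed.

Lemma lim_surj (u : mxlim) : exists n x, u = @lim_in n x.
Proof. by exists (tag (repr u)), (tagged (repr u)); rewrite lim_reprK. Qed.

Lemma lim_surj2 (u v : mxlim) : exists n x y, u = @lim_in n x /\ v = @lim_in n y.
Proof.
have [n [x ->]] := lim_surj u; have [m [y ->]] := lim_surj v.
exists (maxn n m), (to_stage _ x), (to_stage _ y).
by rewrite !lim_in_to ?leq_maxl ?leq_maxr.
Qed.

Lemma lim_surj3 (u v w : mxlim) : exists n x y z,
  [/\ u = @lim_in n x, v = @lim_in n y & w = @lim_in n z].
Proof.
have [n [x [y [-> ->]]]] := lim_surj2 u v; have [m [z ->]] := lim_surj w.
exists (maxn n m), (to_stage _ x), (to_stage _ y), (to_stage _ z).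
by rewrite !lim_in_to ?leq_maxl ?leq_maxr.
Qed.

Section Op2.
Variable op : forall n, mxalg (p ^ n) F -> mxalg (p ^ n) F -> mxalg (p ^ n) F.
Hypothesis opE : forall n k (x y : mxalg (p ^ n) F), (n <= k)%N ->
  to_stage k (op x y) = op (to_stage k x) (to_stage k y).

Definition lim_op2 (u v : mxlim) : mxlim :=
  let k := maxn (tag (repr u)) (tag (repr v)) in
  lim_in (op (to_stage k (tagged (repr u))) (to_stage k (tagged (repr v)))).

Lemma lim_op2E n (x y : mxalg (p ^ n) F) :
  lim_op2 (lim_in x) (lim_in y) = lim_in (op x y).
Proof.
rewrite /lim_op2; set u := repr (lim_in x); set v := repr (lim_in y).
have /lim_inP [k [uk nk e]] : lim_in (tagged u) = lim_in x by rewrite lim_reprK.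
have /lim_inP [l [vl nl f]] : lim_in (tagged v) = lim_in y by rewrite lim_reprK.
set m := maxn _ _; have um : (tag u <= m)%N by exact: leq_maxl.
have vm : (tag v <= m)%N by exact: leq_maxr.
apply/lim_inP; exists (maxn m (maxn k l)); split.
- exact: leq_maxl.
- exact: leq_trans nk (leq_trans (leq_maxl _ _) (leq_maxr _ _)).
rewrite !opE ?leq_maxl //; last first.
  exact: leq_trans nk (leq_trans (leq_maxl _ _) (leq_maxr _ _)).
by rewrite !to_stage_comp // (to_stage_eq _ uk nk e) (to_stage_eq _ vl nl f).
Qed.

End Op2.

Lemma to_stageD n k (x y : mxalg (p ^ n) F) :
  to_stage k (x + y) = to_stage k x + to_stage k y.
Proof. by have := diag_emb_linear (p ^ k).-1 1 x y; rewrite !scale1r. Qed.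

Lemma to_stageZ n k a (x : mxalg (p ^ n) F) :
  to_stage k (a *: x) = a *: to_stage k x.
Proof.
have e0 : to_stage k (0 : mxalg (p ^ n) F) = 0.
  by apply/matrixP => i j; rewrite !mxE; case: ifP; rewrite ?mxE.
have := diag_emb_linear (p ^ k).-1 a x 0.
by rewrite addr0 [X in _ + X]e0 addr0.
Qed.

Lemma to_stageM n k (x y : mxalg (p ^ n) F) : (n <= k)%N ->
  to_stage k (x * y) = to_stage k x * to_stage k y.
Proof. by move=> nk; apply/diag_embM/dvdn_pexp. Qed.

Definition lim_add := lim_op2 (fun n x y => x + y).
Definition lim_mul := lim_op2 (fun n x y => x * y).
Definition lim_scale a (u : mxlim) := lim_in (a *: tagged (repr u)).
Definition lim_opp := lim_scale (-1).
Definition lim_zero := @lim_in 0 0.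
Definition lim_one := @lim_in 0 1.

Lemma lim_addE n (x y : mxalg (p ^ n) F) :
  lim_add (lim_in x) (lim_in y) = lim_in (x + y).
Proof. by apply: (lim_op2E (op := fun n x y => x + y)) => *; exact: to_stageD. Qed.

Lemma lim_mulE n (x y : mxalg (p ^ n) F) :
  lim_mul (lim_in x) (lim_in y) = lim_in (x * y).
Proof. by apply: (lim_op2E (op := fun n x y => x * y)) => *; exact: to_stageM. Qed.

Lemma lim_scaleE a n (x : mxalg (p ^ n) F) :
  lim_scale a (lim_in x) = lim_in (a *: x).
Proof.
rewrite /lim_scale; set u := repr (lim_in x).
have /lim_inP [k [uk nk e]] : lim_in (tagged u) = lim_in x by rewrite lim_reprK.
by apply/lim_inP; exists k; rewrite !to_stageZ e.
Qed.

Lemma lim_zeroE n : lim_zero = lim_in (0 : mxalg (p ^ n) F).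
Proof.
have <- : lim_in (to_stage n 0) = lim_zero := lim_in_to 0 (leq0n n).
by have := to_stageZ n 0 (0 : mxalg (p ^ 0) F); rewrite !scale0r => ->.
Qed.

Lemma lim_oneE n : lim_one = lim_in (1 : mxalg (p ^ n) F).
Proof.
have <- : lim_in (to_stage n 1) = lim_one := lim_in_to 1 (leq0n n).
by rewrite /to_stage diag_emb1.
Qed.

Lemma lim_addA : associative lim_add.
Proof.
move=> u v w; have [n [x [y [z [-> -> ->]]]]] := lim_surj3 u v w.
by rewrite !lim_addE addrA.
Qed.

Lemma lim_addC : commutative lim_add.
Proof.
move=> u v; have [n [x [y [-> ->]]]] := lim_surj2 u v.
by rewrite !lim_addE addrC.
Qed.

Lemma lim_add0 : left_id lim_zero lim_add.
Proof.
by move=> u; have [n [x ->]] := lim_surj u; rewrite (lim_zeroE n) lim_addE add0r.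
Qed.

Lemma lim_addN : left_inverse lim_zero lim_opp lim_add.
Proof.
move=> u; have [n [x ->]] := lim_surj u.
by rewrite (lim_zeroE n) /lim_opp lim_scaleE lim_addE scaleN1r addNr.
Qed.

HB.instance Definition _ := GRing.isZmodule.Build mxlim
  lim_addA lim_addC lim_add0 lim_addN.

Lemma lim_inD n (x y : mxalg (p ^ n) F) : lim_in (x + y) = lim_in x + lim_in y.
Proof. by rewrite [RHS]lim_addE. Qed.

Lemma lim_scaleA a b u : lim_scale a (lim_scale b u) = lim_scale (a * b) u.
Proof. by have [n [x ->]] := lim_surj u; rewrite !lim_scaleE scalerA. Qed.

Lemma lim_scale1 : left_id 1 lim_scale.
Proof.
by move=> u; have [n [x ->]] := lim_surj u; rewrite lim_scaleE scale1r.
Qed.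

Lemma lim_scaleDr : right_distributive lim_scale +%R.
Proof.
move=> a u v; have [n [x [y [-> ->]]]] := lim_surj2 u v.
by rewrite -lim_inD !lim_scaleE scalerDr lim_inD.
Qed.

Lemma lim_scaleDl u : {morph lim_scale^~ u : a b / a + b}.
Proof.
move=> a b; have [n [x ->]] := lim_surj u.
by rewrite !lim_scaleE scalerDl lim_inD.
Qed.

HB.instance Definition _ := GRing.Zmodule_isLmodule.Build F mxlim
  lim_scaleA lim_scale1 lim_scaleDr lim_scaleDl.

Lemma lim_mulA : associative lim_mul.
Proof.
move=> u v w; have [n [x [y [z [-> -> ->]]]]] := lim_surj3 u v w.
by rewrite !lim_mulE mulrA.
Qed.

Lemma lim_mul1l : left_id lim_one lim_mul.
Proof.
by move=> u; have [n [x ->]] := lim_surj u; rewrite (lim_oneE n) lim_mulE mul1r.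
Qed.

Lemma lim_mul1r : right_id lim_one lim_mul.
Proof.
by move=> u; have [n [x ->]] := lim_surj u; rewrite (lim_oneE n) lim_mulE mulr1.
Qed.

Lemma lim_mulDl : left_distributive lim_mul +%R.
Proof.
move=> u v w; have [n [x [y [z [-> -> ->]]]]] := lim_surj3 u v w.
by rewrite -lim_inD !lim_mulE mulrDl lim_inD.
Qed.

Lemma lim_mulDr : right_distributive lim_mul +%R.
Proof.
move=> u v w; have [n [x [y [z [-> -> ->]]]]] := lim_surj3 u v w.
by rewrite -lim_inD !lim_mulE mulrDr lim_inD.
Qed.

Lemma lim_one_neq0 : lim_one != 0 :> mxlim.
Proof.
apply/eqP => /(@lim_inP 0 0) [k [_ _]]; rewrite /to_stage diag_emb1.
have := to_stageZ k 0 (1 : mxalg (p ^ 0) F).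
by rewrite !scale0r /to_stage => -> /eqP; rewrite oner_eq0.
Qed.

HB.instance Definition _ := GRing.Zmodule_isNzRing.Build mxlim
  lim_mulA lim_mul1l lim_mul1r lim_mulDl lim_mulDr lim_one_neq0.

Lemma lim_scaleAl (a : F) (u v : mxlim) : a *: (u * v) = (a *: u) * v.
Proof.
have [n [x [y [-> ->]]]] := lim_surj2 u v.
rewrite [_ * _ in LHS]lim_mulE [LHS]lim_scaleE [a *: _ in RHS]lim_scaleE.
by rewrite [RHS]lim_mulE scalerAl.
Qed.

HB.instance Definition _ := GRing.Lmodule_isLalgebra.Build F mxlim lim_scaleAl.

Lemma lim_scaleAr (a : F) (u v : mxlim) : a *: (u * v) = u * (a *: v).
Proof.
have [n [x [y [-> ->]]]] := lim_surj2 u v.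
rewrite [_ * _ in LHS]lim_mulE [LHS]lim_scaleE [a *: _ in RHS]lim_scaleE.
by rewrite [RHS]lim_mulE scalerAr.
Qed.

HB.instance Definition _ := GRing.Lalgebra_isAlgebra.Build F mxlim lim_scaleAr.

Lemma lim_in1 n : lim_in (1 : mxalg (p ^ n) F) = 1.
Proof. by rewrite -lim_oneE. Qed.

Lemma lim_inM n (x y : mxalg (p ^ n) F) : lim_in (x * y) = lim_in x * lim_in y.
Proof. by rewrite [RHS]lim_mulE. Qed.

Lemma lim_inZ n a (x : mxalg (p ^ n) F) : lim_in (a *: x) = a *: lim_in x.
Proof. by rewrite [RHS]lim_scaleE. Qed.

End Limit.

Section Conditions.
Variables (F : fieldType) (p : nat) (A : algType F).

Definition cond_c1_star : Prop := alg_iso (mxlim F p ⊗ A)%type A.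
Definition cond_c1 : Prop := alg_iso (mxalg p F ⊗ A)%type A.
Definition cond_c2 : Prop := alg_divides (mxalg p F ⊗ A)%type A.
Definition cond_c3_star : Prop := alg_embeds (mxlim F p ⊗ A)%type A.
Definition cond_c3 : Prop := alg_embeds (mxalg p F ⊗ A)%type A.
Definition cond_c4_star : Prop := alg_embeds (mxlim F p) A.
Definition cond_c4 : Prop := forall n : nat, alg_embeds (mxalg (p ^ n) F) A.

End Conditions.

(* Main.v *)
(* A morphism out of M_m ⊗ A is injective as soon as it is so on 1 ⊗ A, and   *)
(* the same holds with M_(p^oo) in place of M_m, since every element of       *)
(* M_(p^oo) ⊗ A comes from a finite stage.                                    *)
(* (c1^* => c1): x ⊗ y |-> (x at stage 1) (1 ⊗ y) is an isomorphism           *)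
(* M_p ⊗ M_(p^oo) -> M_(p^oo), hence M_p ⊗ A = M_p ⊗ M_(p^oo) ⊗ A = A.        *)
(* (c3 => c4^* ): let f and g be the restrictions to M_p and to A of a map    *)
(* M_p ⊗ A -> A. The images of f, g f, g^2 f, ... commute pairwise, and       *)
(* x_0 ⊗ ... ⊗ x_n |-> f x_0 * g (f x_1) * ... * g^n (f x_n) is compatible    *)
(* with the diagonal embeddings, so it defines a map on the direct limit.     *)

Require Import Defs.
From mathcomp Require Import all_boot all_algebra.
From mathcomp Require Import boolp.
From HB Require Import structures.

Set Implicit Arguments.
Unset Strict Implicit.
Unset Printing Implicit Defensive.
Import GRing.Theory.
Local Open Scope ring_scope.

(** Two facts on matrix algebras carry everything. Multiplying by matrix units isolates the
    coefficients of an element of M_m ⊗ A, so injectivity of a morphism is decided on 1 ⊗ A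
    ([mx_tens_inj], [lim_tens_inj]); for A = F this is the simplicity of M_m, and every unital
    morphism out of M_m or of the limit is injective ([mx_inj], [lim_hom]). The Kronecker product
    gives M_m ⊗ M_k = M_(mk) ([kron_iso]), so that one more factor M_p is one step of the direct
    system.

    Two implications have content. From [cond_c1_star] to [cond_c1], the limit absorbs a factor M_p
    ([lim_absorb]). From [cond_c3] to [cond_c4_star], iteration inside A yields commuting copies of
    M_p, whose products extend from each stage to the next ([hom_extend_diag]). The remaining ones
    take F as cofactor or restrict a map to a tensor factor or to a stage. *)

(** * Morphisms out of tensor products and the two inclusions *)

Section Hom.
Variable F : fieldType.
Implicit Types B C D : algType F.

Lemma lrmorphism_of B C (f : B -> C) :
  linear f -> f 1 = 1 -> (forall x y, f (x * y) = f x * f y) ->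
  exists g : {lrmorphism B -> C}, g =1 f.
Proof.
move=> fL f1 fM.
pose f1' := GRing.isLinear.Build F B C *:%R f fL.
pose f2' := GRing.isMonoidMorphism.Build B C f (conj f1 fM).
pose g : {lrmorphism B -> C} := HB.pack f f1' f2'.
by exists g.
Qed.

Lemma lrmorphism_inv B C (f : {lrmorphism B -> C}) :
  bijective f -> exists2 g : {lrmorphism C -> B}, cancel f g & cancel g f.
Proof.
move=> [g fK gK].
have [|||g' gE] := @lrmorphism_of C B g.
- by move=> a x y; apply: (can_inj fK); rewrite gK linearP /= !gK.
- by apply: (can_inj fK); rewrite gK rmorph1.
- by move=> x y; apply: (can_inj fK); rewrite gK rmorphM /= !gK.
by exists g' => x; rewrite gE.
Qed.

Lemma bij_of_inj_surj (T U : Type) (f : T -> U) :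
  injective f -> (forall y, exists x, f x = y) -> bijective f.
Proof.
move=> fI fS; have [g gK] := choice fS.
by exists g => // x; apply: fI.
Qed.

Lemma tens0l B C (c : C) : tens (0 : B) c = 0.
Proof. by rewrite -(scale0r 0) tensZl scale0r. Qed.

Lemma tens0r B C (b : B) : tens b (0 : C) = 0.
Proof. by rewrite -(scale0r 0) tensZr scale0r. Qed.

Lemma tens_suml B C (I : Type) (r : seq I) (P : pred I) (b : I -> B) (c : C) :
  tens (\sum_(i <- r | P i) b i) c = \sum_(i <- r | P i) tens (b i) c.
Proof.
by elim/big_rec2: _ => [|i x y _ <-]; [exact: tens0l | rewrite tensDl].
Qed.

Lemma tens_linear B C (V : lmodType F) (beta : B -> C -> V) :
  (forall c, linear (beta^~ c)) -> (forall b, linear (beta b)) ->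
  exists h : {linear (B ⊗ C)%type -> V}, forall b c, h (tens b c) = beta b c.
Proof.
move=> bl br.
pose h' := GRing.isLinear.Build F _ _ *:%R (tens_lift beta)
  (tens_lift_linear bl br).
pose h : {linear (B ⊗ C)%type -> V} := HB.pack (tens_lift beta) h'.
by exists h; apply: tens_lift_pure.
Qed.

(** Commutation of the images is what makes the induced linear map multiplicative: it swaps [g c]
    and [f b'] in the product. *)
Lemma tens_hom B C D (f : {lrmorphism B -> D}) (g : {lrmorphism C -> D}) :
  (forall b c, GRing.comm (f b) (g c)) ->
  exists h : {lrmorphism (B ⊗ C)%type -> D}, forall b c, h (tens b c) = f b * g c.
Proof.
move=> fg; have [||h hE] := @tens_linear B C D (fun b c => f b * g c).
- by move=> c a x y; rewrite linearP mulrDl -scalerAl.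
- by move=> b a x y; rewrite linearP mulrDr -scalerAr.
have [|||h' h'E] := @lrmorphism_of (B ⊗ C)%type D h.
- exact: linearP.
- by rewrite [1 in LHS](_ : _ = tens 1 1) // hE !rmorph1 mulr1.
- elim/tens_ind => [|b c x IH] y; first by rewrite !(mul0r, raddf0).
  rewrite mulrDl !raddfD /= mulrDl IH; congr (_ + _).
  elim/tens_ind: y => [|b' c' y IHy]; first by rewrite !(mulr0, raddf0).
  rewrite mulrDr !raddfD /= mulrDr IHy; congr (_ + _).
  by rewrite tensM !hE !rmorphM /= !mulrA -(mulrA (f b)) fg !mulrA.
by exists h' => b c; rewrite h'E hE.
Qed.

(** A linear functional [l] on C with [l 1 = 1] gives the linear retraction b ⊗ c |-> l(c) b, whence
    injectivity. *)
Lemma tens_inl B C : exists2 f : {lrmorphism B -> (B ⊗ C)%type},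
  injective f & forall b, f b = tens b 1.
Proof.
have [|//|x y|f fE] := @lrmorphism_of B (B ⊗ C)%type (fun b => tens b 1).
- by move=> a x y; rewrite tensDl tensZl.
- by rewrite tensM mulr1.
have [l [lL l1]] := functional_exists (oner_neq0 C).
have [||h hE] := @tens_linear B C B (fun b c => l c *: b).
- by move=> c a u v; rewrite scalerDr !scalerA mulrC.
- by move=> b a u v; rewrite lL scalerDl scalerA.
exists f => //; apply: (@can_inj _ _ _ h) => b.
by rewrite fE hE l1 scale1r.
Qed.

Lemma tens_inr B C : exists2 f : {lrmorphism C -> (B ⊗ C)%type},
  injective f & forall c, f c = tens 1 c.
Proof.
have [|//|x y|f fE] := @lrmorphism_of C (B ⊗ C)%type (tens 1).
- by move=> a x y; rewrite tensDr tensZr.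
- by rewrite tensM mulr1.
have [l [lL l1]] := functional_exists (oner_neq0 B).
have [||h hE] := @tens_linear B C C (fun b c => l b *: c).
- by move=> c a u v; rewrite lL scalerDl scalerA.
- by move=> b a u v; rewrite scalerDr !scalerA mulrC.
exists f => //; apply: (@can_inj _ _ _ h) => c.
by rewrite fE hE l1 scale1r.
Qed.

End Hom.

(** * Injectivity of morphisms out of matrix algebras *)

Section MatrixDomain.
Variables (F : fieldType) (m : nat).
Implicit Types A C : algType F.

(* The sum over k of e_ki w e_jk is 1 ⊗ a_ij, where w is the sum of the       *)
(* e_ij ⊗ a_ij.                                                               *)
Lemma mx_tens_inj A C (h : {lrmorphism ('M[F]_m.+1 ⊗ A)%type -> C}) :
  (forall a, h (tens 1 a) = 0 -> a = 0) -> injective h.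
Proof.
move=> hA; apply: raddf_inj => w hw.
have [a wE] : exists a : 'I_m.+1 -> 'I_m.+1 -> A,
    w = \sum_i \sum_j tens (delta_mx i j) (a i j).
  elim/tens_ind: w {hw} => [|b c x [a ->]].
    exists (fun _ _ => 0); rewrite big1 // => i _; rewrite big1 // => j _.
    by rewrite tens0r.
  exists (fun i j => b i j *: c + a i j).
  under [RHS]eq_bigr do under eq_bigr do rewrite tensDr.
  under [RHS]eq_bigr do rewrite big_split.
  rewrite big_split /=; congr (_ + _).
  rewrite {1}(matrix_sum_delta b) tens_suml; apply: eq_bigr => i _.
  by rewrite tens_suml; apply: eq_bigr => j _; rewrite tensZl tensZr.
suff a0 i j : a i j = 0.
  rewrite wE big1 // => i _; rewrite big1 // => j _.
  by rewrite a0 tens0r.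
apply: hA; have -> : tens (1 : 'M[F]_m.+1) (a i j) =
    \sum_k tens (delta_mx k i) 1 * w * tens (delta_mx j k) 1.
  have -> : (1 : 'M[F]_m.+1) = \sum_k delta_mx k k.
    rewrite [LHS]matrix_sum_delta; apply: eq_bigr => k _.
    rewrite (bigD1 k) //= big1 ?addr0; last first.
      by move=> l lk; rewrite !mxE eq_sym (negbTE lk) scale0r.
    by rewrite !mxE eqxx scale1r.
  rewrite tens_suml; apply: eq_bigr => k _; rewrite wE.
  rewrite mulr_sumr mulr_suml (bigD1 i) //= mulr_sumr mulr_suml (bigD1 j) //=.
  rewrite !tensM mulr1 mul1r -!mulmxE !mul_delta_mx.
  rewrite !big1 ?addr0 // => [l li|l lj].
    rewrite mulr_sumr mulr_suml big1 // => r _.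
    rewrite !tensM -!mulmxE mul_delta_mx_0 1?eq_sym // mul0mx.
    by rewrite tens0l.
  rewrite !tensM -!mulmxE mul_delta_mx mul_delta_mx_0 //.
  by rewrite tens0l.
rewrite rmorph_sum big1 // => k _.
by rewrite !rmorphM /= hw mulr0 mul0r.
Qed.

(** The case A = F of [mx_tens_inj]: [h] together with the scalars of C defines a map on M ⊗ F, and
    it is injective on 1 ⊗ F because 1 != 0 in C. *)
Lemma mx_inj C (h : {lrmorphism 'M[F]_m.+1 -> C}) : injective h.
Proof.
have [|||g gE] := @lrmorphism_of F F^o C (fun c => c *: 1).
- by move=> a x y; rewrite scalerDl scalerA.
- exact: scale1r.
- by move=> x y; rewrite -scalerAl mul1r scalerA.
have [|k kE] := tens_hom (f := h) (g := g).
  by move=> b c; rewrite /GRing.comm gE -scalerAr mulr1 -scalerAl mul1r.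
have kI : injective k.
  apply: mx_tens_inj => a; rewrite kE gE rmorph1 mul1r => /eqP.
  by rewrite scaler_eq0 oner_eq0 orbF => /eqP.
have [j jI jE] := @tens_inl F 'M[F]_m.+1 F^o.
move=> x y e; apply: jI; apply: kI.
by rewrite !jE !kE rmorph1 !mulr1.
Qed.

End MatrixDomain.

(** * Kronecker products, an index being split into quotient and remainder modulo [m.+1] *)

Section Kronecker.
Variables (F : fieldType) (m k n : nat).
Hypothesis nE : n.+1 = (k.+1 * m.+1)%N.

Let hi (i : 'I_n.+1) : 'I_k.+1 := inord (i %/ m.+1).
Let lo (i : 'I_n.+1) : 'I_m.+1 := inord (i %% m.+1).
Let jn (a : 'I_k.+1) (b : 'I_m.+1) : 'I_n.+1 := inord (a * m.+1 + b).

Let hiE i : hi i = (i %/ m.+1)%N :> nat.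
Proof. by rewrite inordK // ltn_divLR // -nE. Qed.

Let loE i : lo i = (i %% m.+1)%N :> nat.
Proof. by rewrite inordK // ltn_mod. Qed.

Let jnE a b : jn a b = (a * m.+1 + b)%N :> nat.
Proof.
rewrite inordK // nE; apply: (@leq_trans (a.+1 * m.+1)).
  by rewrite mulSn addnC ltn_add2r.
by rewrite leq_mul2r ltn_ord orbT.
Qed.

Let hi_jn a b : hi (jn a b) = a.
Proof. by apply: val_inj; rewrite /= hiE jnE divnMDl // divn_small ?addn0. Qed.

Let lo_jn a b : lo (jn a b) = b.
Proof. by apply: val_inj; rewrite /= loE jnE modnMDl modn_small. Qed.

Let jn_hi_lo i : jn (hi i) (lo i) = i.
Proof. by apply: val_inj; rewrite /= jnE hiE loE -divn_eq. Qed.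

Let sum_jn (V : nmodType) (G : 'I_n.+1 -> V) :
  \sum_i G i = \sum_a \sum_b G (jn a b).
Proof.
rewrite pair_big /= (reindex (fun q => jn q.1 q.2)) //.
exists (fun i => (hi i, lo i)) => [[a b] _|i _] /=.
  by rewrite hi_jn lo_jn.
by rewrite jn_hi_lo.
Qed.

(* Blocks of length m.+1, so that [kron x 1] is diag(x, ..., x): the fast     *)
(* index is the one of x.                                                     *)
Definition kron (x : 'M[F]_m.+1) (y : 'M[F]_k.+1) : 'M[F]_n.+1 :=
  \matrix_(i, j) (x (inord (i %% m.+1)) (inord (j %% m.+1))
                 * y (inord (i %/ m.+1)) (inord (j %/ m.+1))).

Lemma kronM x x' y y' : kron x y * kron x' y' = kron (x * x') (y * y').
Proof.
apply/matrixP => i j; rewrite -!mulmxE !mxE -/(lo i) -/(lo j) -/(hi i) -/(hi j).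
rewrite sum_jn mulr_sumr; apply: eq_bigr => a _.
rewrite mulr_suml; apply: eq_bigr => b _.
by rewrite !mxE -/(lo (jn a b)) -/(hi (jn a b)) hi_jn lo_jn mulrACA.
Qed.

Lemma kron1 : kron 1 1 = 1.
Proof.
apply/matrixP => i j; rewrite !mxE -natrM mulnb; congr (nat_of_bool _)%:R.
rewrite -/(lo i) -/(lo j) -/(hi i) -/(hi j).
apply/andP/eqP => [[/eqP e /eqP e']|->]; last by rewrite !eqxx.
by rewrite -(jn_hi_lo i) e e' jn_hi_lo.
Qed.

Lemma diag_emb_kron x : diag_emb n x = kron x 1.
Proof.
apply/matrixP => i j; rewrite !mxE -/(hi i) -/(hi j) -val_eqE /= !hiE.
by case: eqP; rewrite ?mulr1 ?mulr0.
Qed.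

Lemma kron_linearr x : linear (kron x).
Proof. by move=> a y y'; apply/matrixP => i j; rewrite !mxE mulrDr mulrCA. Qed.

Lemma kron_homr : exists f : {lrmorphism 'M[F]_k.+1 -> 'M[F]_n.+1},
  f =1 kron 1.
Proof.
apply: lrmorphism_of => [||x y]; first exact: kron_linearr.
  exact: kron1.
by rewrite kronM mulr1.
Qed.

Lemma diag_hom : exists f : {lrmorphism 'M[F]_m.+1 -> 'M[F]_n.+1},
  f =1 diag_emb n.
Proof.
apply: lrmorphism_of => [||x y]; first exact: diag_emb_linear.
  exact: diag_emb1.
by rewrite diag_embM // nE dvdn_mull.
Qed.

Lemma kron_iso :
  exists2 h : {lrmorphism ('M[F]_m.+1 ⊗ 'M[F]_k.+1)%type -> 'M[F]_n.+1},
    bijective h & forall x y, h (tens x y) = diag_emb n x * kron 1 y.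
Proof.
have [f fE] := diag_hom; have [g gE] := kron_homr.
have [|h hE] := tens_hom (f := f) (g := g).
  by move=> x y; rewrite /GRing.comm fE gE diag_emb_kron !kronM !mulr1 !mul1r.
exists h; last by move=> x y; rewrite hE fE gE.
apply: bij_of_inj_surj.
  apply: mx_tens_inj => y; rewrite hE rmorph1 mul1r => g0.
  by apply: (@mx_inj _ _ _ g); rewrite g0 raddf0.
(* The preimage sorts the entries of [z] by their remainders (i, j), the coefficient of each matrix
   unit being the submatrix of [z] on the quotients. *)
move=> z; exists (\sum_i \sum_j
  tens (delta_mx i j) (\matrix_(a, b) z (jn a i) (jn b j))).
apply/matrixP => r s; rewrite raddf_sum summxE (bigD1 (lo r)) //= raddf_sum.
rewrite summxE (bigD1 (lo s)) //= !big1 ?addr0.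
- rewrite hE fE gE diag_emb_kron kronM mulr1 mul1r !mxE.
  by rewrite -/(lo r) -/(lo s) -/(hi r) -/(hi s) !eqxx mul1r !jn_hi_lo.
- move=> i ir; rewrite raddf_sum summxE big1 // => j _.
  rewrite /= hE fE gE diag_emb_kron kronM mulr1 mul1r !mxE -/(lo r) eq_sym.
  by rewrite (negbTE ir) mul0r.
move=> j js; rewrite hE fE gE diag_emb_kron kronM mulr1 mul1r !mxE -/(lo s).
by rewrite (eq_sym _ j) (negbTE js) andbF mul0r.
Qed.

(** [h] is f ⊗ g read through [kron_iso]. The second clause holds since the products [f x * g y]
    span its image; it keeps the commutation invariant alive when the lemma is iterated. *)
Lemma hom_extend_diag (C : algType F) (f : {lrmorphism 'M[F]_m.+1 -> C})
    (g : {lrmorphism 'M[F]_k.+1 -> C}) :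
  (forall x y, GRing.comm (f x) (g y)) ->
  exists h : {lrmorphism 'M[F]_n.+1 -> C},
    (forall x, h (diag_emb n x) = f x) /\
    (forall c, (forall x, GRing.comm (f x) c) -> (forall y, GRing.comm (g y) c) ->
       forall z, GRing.comm (h z) c).
Proof.
move=> fg; have [u uE] := tens_hom fg; have [h hb hE] := kron_iso.
have [h' hK h'K] := lrmorphism_inv hb.
have [e eE] := @lrmorphism_of F _ _ (u \o h') (linearP _) (rmorph1 _) (rmorphM _).
exists e; split=> [x|c fc gc z].
  by rewrite eE /= -[diag_emb n x]mulr1 -kron1 -hE hK uE rmorph1 mulr1.
rewrite eE /=; elim/tens_ind: (h' z) => [|x y w IH].
  by rewrite raddf0; apply: commr_sym; apply: commr0.
rewrite raddfD /= uE; apply: commr_sym; apply: commrD; last exact: commr_sym.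
by apply: commrM; apply: commr_sym.
Qed.

End Kronecker.

(** Write an index with a lowest digit in base [m.+1], the next in base [k.+1], and the rest on top.
    Both sides apply [x] to the middle digit and the identity to the others. *)
Lemma diag_emb_kronr (F : fieldType) m k k' n n' (x : 'M[F]_k.+1) :
  n.+1 = (k.+1 * m.+1)%N -> n'.+1 = (k'.+1 * m.+1)%N -> (k.+1 %| k'.+1)%N ->
  diag_emb n' (kron n (1 : 'M[F]_m.+1) x) =
  kron n' (1 : 'M[F]_m.+1) (diag_emb k' x).
Proof.
move=> nE n'E kk'; apply/matrixP => i j; rewrite !mxE.
have lo (a : nat) : (a %% n.+1 %% m.+1 = a %% m.+1)%N.
  by rewrite modn_dvdm // nE dvdn_mull.
have hi (a : nat) : (a %% n.+1 %/ m.+1 = a %/ m.+1 %% k.+1)%N.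
  by rewrite nE modn_divl.
have top (a : nat) : (a %/ n.+1 = a %/ m.+1 %/ k.+1)%N.
  by rewrite nE mulnC divnMA.
have inmod (a : nat) : (inord (a %% n.+1) : 'I_n.+1) = (a %% n.+1)%N :> nat.
  by rewrite inordK // ltn_mod.
have indiv (a : 'I_n'.+1) : (inord (a %/ m.+1) : 'I_k'.+1) = (a %/ m.+1)%N :> nat.
  by rewrite inordK // ltn_divLR // -n'E.
by rewrite !top !indiv; case: ifP => _; rewrite ?mulr0 // !inmod !lo !hi.
Qed.

(** * Morphisms out of the direct limit, and its absorption of a factor M_p *)

Section Limit.
Variables (F : fieldType) (p : nat).
Implicit Types A C : algType F.

Lemma lim_in_hom n :
  exists2 f : {lrmorphism mxalg (p ^ n) F -> mxlim F p},
    injective f & f =1 @lim_in F p n.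
Proof.
have [|||f fE] := @lrmorphism_of F _ _ (@lim_in F p n).
- by move=> a x y; rewrite lim_inD lim_inZ.
- exact: lim_in1.
- exact: lim_inM.
by exists f => //; apply: mx_inj.
Qed.

(** Injectivity comes for free: two elements of the limit live at a common stage, where [mx_inj]
    applies. *)
Lemma lim_hom C (f : forall n, {lrmorphism mxalg (p ^ n) F -> C}) :
  (forall n x, f n.+1 (to_stage n.+1 x) = f n x) ->
  exists2 g : {lrmorphism mxlim F p -> C},
    injective g & forall n x, g (@lim_in F p n x) = f n x.
Proof.
move=> f_succ.
have f_stage n k x : (n <= k)%N -> f k (to_stage k x) = f n x.
  elim: k => [|k IH]; first by case: n x => // x _; rewrite /to_stage diag_emb_id.
  rewrite leq_eqVlt => /predU1P [<-|nk]; first by rewrite /to_stage diag_emb_id.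
  by rewrite -(to_stage_comp _ x nk) f_succ IH.
pose g (u : mxlim F p) := f _ (tagged (repr u : stage F p)).
have gE n x : g (@lim_in F p n x) = f n x.
  rewrite /g; set u := repr _.
  have /lim_inP [k [uk nk e]] : lim_in (tagged u) = lim_in x by rewrite lim_reprK.
  by rewrite -(f_stage _ k _ uk) e f_stage.
have [|||h hE] := @lrmorphism_of F _ _ g.
- move=> a u v; have [n [x [y [-> ->]]]] := lim_surj2 u v.
  by rewrite -lim_inZ -lim_inD !gE linearP.
- by rewrite -(lim_in1 F p 0) gE rmorph1.
- move=> u v; have [n [x [y [-> ->]]]] := lim_surj2 u v.
  by rewrite -lim_inM !gE rmorphM.
exists h; last by move=> n x; rewrite hE gE.
move=> u v; have [n [x [y [-> ->]]]] := lim_surj2 u v.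
by rewrite !hE !gE => /mx_inj ->.
Qed.

Lemma lim_tens_inj A C (h : {lrmorphism (mxlim F p ⊗ A)%type -> C}) :
  (forall a, h (tens 1 a) = 0 -> a = 0) -> injective h.
Proof.
move=> hA; apply: raddf_inj => w hw.
have [n [s wE]] : exists n (s : seq (mxalg (p ^ n) F * A)),
    w = \sum_(y <- s) tens (lim_in y.1) y.2.
  elim/tens_ind: w {hw} => [|u a w [n [s ->]]].
    by exists 0%N, [::]; rewrite big_nil.
  (* The new term and the old sum are both raised to the common stage [k]. *)
  have [m [y ->]] := lim_surj u; pose k := maxn m n.
  exists k, ((to_stage k y, a) :: [seq (to_stage k z.1, z.2) | z <- s]).
  rewrite big_cons big_map lim_in_to ?leq_maxl //; congr (_ + _).
  by apply: eq_bigr => z _; rewrite lim_in_to ?leq_maxr.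
have [i _ iE] := lim_in_hom n.
have [l _ lE] := @tens_inl F (mxlim F p) A.
have [r _ rE] := @tens_inr F (mxlim F p) A.
have [|f fE] := tens_hom (f := l \o i) (g := r).
  by move=> x a; rewrite /GRing.comm /= lE rE !tensM !mulr1 !mul1r.
have {}fE x a : f (tens x a) = tens (lim_in x) a.
  by rewrite fE /= lE rE iE tensM mulr1 mul1r.
have hfI : injective (h \o f).
  by apply: mx_tens_inj => a; rewrite /= fE lim_in1; apply: hA.
have {}wE : w = f (\sum_(y <- s) tens y.1 y.2).
  by rewrite raddf_sum wE; apply: eq_bigr => y _; rewrite /= fE.
suff s0 : \sum_(y <- s) tens y.1 y.2 = 0 by rewrite wE s0 raddf0.
by apply: hfI; rewrite /= -wE hw !raddf0.
Qed.

Hypothesis p_gt0 : (0 < p)%N.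

Lemma stageSE n : (p ^ n.+1).-1.+1 = ((p ^ n).-1.+1 * p.-1.+1)%N.
Proof. by rewrite !prednK ?expn_gt0 ?p_gt0 // expnSr. Qed.

(** M_p enters at stage 1, on the lowest digit of the indices, while stage n is shifted to stage n +
    1 as 1 ⊗ x, on the higher digits. The shift respects the diagonal embeddings, and the two images
    commute and together fill each stage n + 1. *)
Lemma lim_absorb :
  exists h : {lrmorphism (mxalg p F ⊗ mxlim F p)%type -> mxlim F p}, bijective h.
Proof.
have ex n : {f : {lrmorphism mxalg (p ^ n) F -> mxlim F p}
    | forall x, f x = @lim_in F p n.+1 (kron _ (1 : mxalg p F) x)}.
  apply: cid; have [g gE] := kron_homr F (stageSE n).
  have [i _ iE] := lim_in_hom n.+1.
  by exists (i \o g) => x; rewrite /= iE gE.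
have [n x|b bI bE] := @lim_hom _ (fun n => sval (ex n)).
  rewrite !(svalP (ex _)) -[RHS](@lim_in_to _ _ n.+1 n.+2) //; congr lim_in.
  rewrite /to_stage (diag_emb_kronr x (stageSE n) (stageSE n.+1)) //.
  exact: dvdn_pexp.
have {}bE n x : b (@lim_in F p n x) = @lim_in F p n.+1 (kron _ (1 : mxalg p F) x).
  by rewrite bE (svalP (ex n)).
have [a _ aE] := lim_in_hom 1.
have {}aE n (x : mxalg p F) : a x = @lim_in F p n.+1 (diag_emb _ x).
  by rewrite aE -[LHS](@lim_in_to _ _ 1 n.+1).
have [|h hE] := @tens_hom F (mxalg p F) _ _ a b.
  move=> x u; have [n [y ->]] := lim_surj u.
  rewrite (aE n) bE /GRing.comm -!lim_inM (diag_emb_kron (stageSE n)).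
  by rewrite !(kronM (stageSE n)) !mulr1 !mul1r.
exists h; apply: bij_of_inj_surj.
  apply: mx_tens_inj => u; rewrite hE rmorph1 mul1r => bu0.
  by apply: bI; rewrite bu0 raddf0.
move=> u; have [n [z ->]] := lim_surj u.
have [i _ iE] := lim_in_hom n.+1.
rewrite -(@lim_in_to _ _ n n.+1) // -iE.
have [k [k' _ k'K] kE] := kron_iso F (stageSE n).
rewrite -(k'K (to_stage _ _)); elim/tens_ind: (k' _) => [|x y w [v vE]].
  by exists 0; rewrite !raddf0.
exists (tens x (@lim_in F p n y) + v).
by rewrite !raddfD /= -vE kE iE lim_inM hE (aE n) bE.
Qed.

End Limit.

Lemma mx11_hom (F : fieldType) (A : algType F) :
  exists f : {lrmorphism 'M[F]_1 -> A}, forall x, f x = x 0 0 *: 1.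
Proof.
apply: lrmorphism_of => [a x y||x y].
- by rewrite !mxE scalerDl scalerA.
- by rewrite mxE eqxx scale1r.
by rewrite -mulmxE mxE big_ord1 -scalerAl mul1r scalerA.
Qed.

(** * The implications between the conditions *)

Section Implications.
Variables (F : fieldType) (p : nat) (A : algType F).

Lemma c1_star_c1 : (0 < p)%N -> cond_c1_star p A -> cond_c1 p A.
Proof.
move=> p_gt0 [H Hb]; have [H' HK H'K] := lrmorphism_inv Hb.
have [h [h' _ h'K]] := lim_absorb F p_gt0.
have [i _ iE] := @tens_inl F (mxlim F p) A.
have [j jI jE] := @tens_inr F (mxlim F p) A.
have [l _ lE] := @tens_inl F (mxalg p F) (mxlim F p).
have [r _ rE] := @tens_inr F (mxalg p F) (mxlim F p).
(* [T] is the shift of the limit tensored with A. It frees a copy of M_p, whose image under [H]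
   commutes with that of [T]. *)
have [|T TE] := tens_hom (f := i \o h \o r) (g := j).
  by move=> x a; rewrite /GRing.comm /= iE jE !tensM !mulr1 !mul1r.
have {}TE y a : T (tens y a) = tens (h (tens 1 y)) a.
  by rewrite TE /= iE jE rE tensM mulr1 mul1r.
have TI : injective T.
  have h1 : h (tens 1 1) = 1 := rmorph1 h.
  apply: lim_tens_inj => a; rewrite TE h1 -jE => ja0.
  by apply: jI; rewrite ja0 raddf0.
have [|Phi PhiE] := tens_hom (f := H \o i \o h \o l) (g := H \o T \o H').
  move=> x a; rewrite /GRing.comm /= -!rmorphM iE lE; congr (H _).
  elim/tens_ind: (H' a) => [|y b w IH].
    by rewrite raddf0 mulr0 mul0r.
  rewrite raddfD /= mulrDr mulrDl IH TE !tensM mulr1 mul1r -!rmorphM !tensM.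
  by rewrite !mul1r !mulr1.
exists Phi; apply: bij_of_inj_surj.
  apply: mx_tens_inj => a; rewrite PhiE rmorph1 mul1r /= => e.
  by apply: (can_inj H'K); apply: TI; apply: (can_inj HK); rewrite e !raddf0.
move=> a; rewrite -(H'K a); elim/tens_ind: (H' a) => [|y b w [v vE]].
  by exists 0; rewrite !raddf0.
rewrite -(h'K y); elim/tens_ind: (h' y) => [|x z t [v' v'E]].
  by exists v; rewrite raddf0 tens0l add0r.
(* Indeed h(x ⊗ z) ⊗ b is the product of h(x ⊗ 1) ⊗ 1 and T(z ⊗ b). *)
exists (tens x (H (tens z b)) + v').
rewrite (raddfD Phi) (raddfD h) tensDl -addrA (raddfD H) /= -v'E PhiE /= HK.
rewrite TE -rmorphM; congr (H _ + _).
by rewrite iE lE tensM mul1r -rmorphM tensM mulr1 mul1r.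
Qed.

Lemma c1_c2 : cond_c1 p A -> cond_c2 p A.
Proof.
move=> [h hb]; have [h' hK h'K] := lrmorphism_inv hb.
(* The cofactor is F itself: x ⊗ c = cx ⊗ 1 makes the inclusion bijective. *)
exists F^o; have [i iI iE] := @tens_inl F (mxalg p F ⊗ A)%type F^o.
exists (i \o h'); apply: bij_comp; last by exists h.
apply: bij_of_inj_surj => // w; elim/tens_ind: w => [|x c w [v vE]].
  by exists 0; rewrite raddf0.
exists (c *: x + v); rewrite raddfD /= vE iE tensZl -tensZr.
by congr (tens _ _ + _); apply: mulr1.
Qed.

Lemma c2_c3 : cond_c2 p A -> cond_c3 p A.
Proof.
move=> [B' [h hb]]; have [h' hK h'K] := lrmorphism_inv hb.
have [i iI iE] := @tens_inl F (mxalg p F ⊗ A)%type B'.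
by exists (h' \o i); apply: inj_comp => //; apply: can_inj h'K.
Qed.

Lemma c3_c4_star : (0 < p)%N -> cond_c3 p A -> cond_c4_star p A.
Proof.
move=> p_gt0 [h _].
have [i _ iE] := @tens_inl F (mxalg p F) A.
have [j _ jE] := @tens_inr F (mxalg p F) A.
pose f : {lrmorphism mxalg p F -> A} := h \o i.
pose g : {lrmorphism A -> A} := h \o j.
have fg x a : GRing.comm (f x) (g a).
  by rewrite /GRing.comm /= -!rmorphM iE jE !tensM !mulr1 !mul1r.
have gn_ex n : {e : {lrmorphism A -> A} | e =1 iter n g}.
  apply: cid; elim: n => [|n [e eE]]; first by exists idfun.
  by exists (g \o e) => a /=; rewrite eE.
have f0 : {f0 : {lrmorphism mxalg (p ^ 0) F -> A} |
    forall x a, GRing.comm (f0 x) (iter 0 g a)}.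
  apply: cid; have [f0 f0E] := mx11_hom A.
  by exists f0 => x a; rewrite /GRing.comm f0E -scalerAr mulr1 -scalerAl mul1r.
(* Invariant: the map on stage n commutes with the image of g^n, so it can be multiplied by g^n f on
   the new factor M_p. The result commutes with g^(n+1) a = g^n (g a), because f and g commute.
   Sigma types make the choices data for the recursion [fn]. *)
have fS n (u : {f : {lrmorphism mxalg (p ^ n) F -> A} |
    forall x a, GRing.comm (f x) (iter n g a)}) :
  {v : {f : {lrmorphism mxalg (p ^ n.+1) F -> A} |
    forall x a, GRing.comm (f x) (iter n.+1 g a)} |
    forall x, sval v (to_stage n.+1 x) = sval u x}.
  apply: cid; case: u => u' u'C; have [e eE] := gn_ex n.
  have nE : (p ^ n.+1).-1.+1 = (p.-1.+1 * (p ^ n).-1.+1)%N.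
    by rewrite mulnC; apply: stageSE.
  have [|v [vE vC]] := hom_extend_diag nE (f := u') (g := e \o f).
    by move=> x y; rewrite /= eE; apply: u'C.
  have vgC x a : GRing.comm (v x) (iter n.+1 g a).
    rewrite iterSr; apply: vC => y; first exact: u'C.
    rewrite -eE /GRing.comm [LHS](esym (rmorphM e _ _)).
    by rewrite [RHS](esym (rmorphM e _ _)) fg.
  by exists (exist _ v vgC) => x; apply: vE.
pose fn := fix fn n := if n is n'.+1 then sval (fS n' (fn n')) else f0.
have [n x|k kI _] := @lim_hom _ _ _ (fun n => sval (fn n)).
  exact: (svalP (fS n (fn n))).
by exists k.
Qed.

Lemma c4_star_c4 : cond_c4_star p A -> cond_c4 p A.
Proof.
move=> [h hI] n; have [i iI _] := lim_in_hom F p n.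
by exists (h \o i); apply: inj_comp.
Qed.

Lemma c1_star_c3_star : cond_c1_star p A -> cond_c3_star p A.
Proof. by move=> [h /bij_inj hI]; exists h. Qed.

Lemma c3_star_c3 : cond_c3_star p A -> cond_c3 p A.
Proof.
(* M_p is stage 1 of the limit. *)
move=> [h hI]; have [i _ iE] := lim_in_hom F p 1.
have [l _ lE] := @tens_inl F (mxlim F p) A.
have [r rI rE] := @tens_inr F (mxlim F p) A.
have [|f fE] := @tens_hom F (mxalg p F) A _ (l \o i) r.
  by move=> x a; rewrite /GRing.comm /= lE rE !tensM !mulr1 !mul1r.
exists (h \o f); apply: inj_comp => //; apply: mx_tens_inj => a.
by rewrite fE rmorph1 mul1r => ra0; apply: rI; rewrite ra0 raddf0.
Qed.

End Implications.

Theorem proposition3p3 (F : fieldType) (p : nat) (hp : prime p) (A : algType F) :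
  [/\ (cond_c1_star p A -> cond_c1 p A),
      (cond_c1 p A -> cond_c2 p A),
      (cond_c2 p A -> cond_c3 p A),
      (cond_c3 p A -> cond_c4_star p A)
    & (cond_c4_star p A -> cond_c4 p A)] /\
  ((cond_c1_star p A -> cond_c3_star p A) /\
   (cond_c3_star p A -> cond_c3 p A)).
Proof.
have p_gt0 := prime_gt0 hp.
split; last by split; [exact: c1_star_c3_star | exact: c3_star_c3].
split; [exact: c1_star_c1 | exact: c1_c2 | exact: c2_c3 | exact: c3_c4_star |].
exact: c4_star_c4.
Qed.
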